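(* (Skolemization) Every Skolem fibration $p:\mathsf{E}\to\mathsf{B}$ validates the principle $\forall x\,\exists y\,\alpha(i,x,y)\cong\exists f\,\forall x\,\alpha(i,x,fx)$. That is, for all objects $A_1,A_2,B$ of $\mathsf{B}$ and every $\alpha\in\mathsf{E}_{A_1\times A_2\times B}$ there is an isomorphism in $\mathsf{E}_{A_1}$ $$\prod_{\pi_1}\coprod_{\langle\pi_1,\pi_2\rangle}\alpha\;\cong\;\coprod_{\pi_1}\prod_{\langle\pi_1,\pi_3\rangle}\langle\pi_1,\pi_2,\mathrm{ev}\langle\pi_2,\pi_3\rangle\rangle^*\alpha ,$$ where on the left $\langle\pi_1,\pi_2\rangle:A_1\times A_2\times B\to A_1\times A_2$ and $\pi_1:A_1\times A_2\to A_1$ are the projections, and on the right $\pi_1,\pi_2,\pi_3$ inside the reindexing are the projections from $A_1\times A_2\times B^{A_2}$, $\mathrm{ev}:A_2\times B^{A_2}\to B$ is evaluation, $\langle\pi_1,\pi_3\rangle:A_1\times A_2\times B^{A_2}\to A_1\times B^{A_2}$, and the outer $\pi_1:A_1\times B^{A_2}\to A_1$ is the projection.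
   Context: Conventions. All fibrations are cloven and split (reindexing is strictly functorial) and have a base category with finite products. For $p:\mathsf{E}\to\mathsf{B}$ and $I\in\mathsf{B}$, $\mathsf{E}_I$ is the fibre category over $I$ (its arrows are called vertical); for $u:A\to B$ in $\mathsf{B}$, $u^*:\mathsf{E}_B\to\mathsf{E}_A$ is reindexing. Simple (co)products. $p$ has simple coproducts if for every projection $\pi_I:I\times X\to I$ the functor $\pi_I^*$ has a left adjoint $\coprod_{\pi_I}$, and the Beck-Chevalley condition holds: for every $f:I\to J$ the canonical map $\coprod_{\pi_I}(f\times 1_X)^*\to f^*\coprod_{\pi_J}$ is invertible (with $\pi_J:J\times X\to J$). Dually, $p$ has simple products if each $\pi_I^*$ has a right adjoint $\prod_{\pi_I}$ satisfying the Beck-Chevalley condition. $\coprod$-quantifier-free. If $p$ has simple coproducts, $\alpha\in\mathsf{E}_I$ is $\coprod$-quantifier-free if for every $f:A\to I$, every projection $\pi_A:A\times B\to A$, every $\beta\in\mathsf{E}_{A\times B}$ and every vertical arrow $h:f^*\alpha\to\coprod_{\pi_A}\beta$ of $\mathsf{E}_A$, there exist a unique $g:A\to B$ in $\mathsf{B}$ and a unique vertical arrow $\overline h:f^*\alpha\to\langle 1_A,g\rangle^*\beta$ such that $h=(\langle 1_A,g\rangle^*\eta_\beta)\,\overline h$, where $\eta_\beta:\beta\to\pi_A^*\coprod_{\pi_A}\beta$ is the unit of $\coprod_{\pi_A}\dashv\pi_A^*$. $p$ has enough $\coprod$-quantifier-free objects if for every $I$ and every $\alpha\in\mathsf{E}_I$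 there are an object $A$ and a $\coprod$-quantifier-free $\beta\in\mathsf{E}_{I\times A}$ with $\alpha\cong\coprod_{\pi_I}\beta$. Skolem fibration. $p$ is a Skolem fibration if: $\mathsf{B}$ is cartesian closed; $p$ has simple products and simple coproducts; $p$ has enough $\coprod$-quantifier-free objects; and if $\alpha\in\mathsf{E}_I$ is $\coprod$-quantifier-free then so is $\prod_\pi\alpha$ for every projection $\pi$ from $I$. *)

(* Defs.v *)
From Stdlib Require Import ProofIrrelevance.

Set Implicit Arguments.
Unset Strict Implicit.
Unset Printing Implicit Defensive.

Declare Scope cat_scope.
Delimit Scope cat_scope with cat.
Open Scope cat_scope.

Record category := Category {
  ob :> Type;
  hom : ob -> ob -> Type;
  idn : forall X, hom X X;
  comp : forall X Y Z, hom Y Z -> hom X Y -> hom X Z;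
  comp_idl : forall X Y (f : hom X Y), comp (idn Y) f = f;
  comp_idr : forall X Y (f : hom X Y), comp f (idn X) = f;
  comp_assoc : forall X Y Z W (h : hom Z W) (g : hom Y Z) (f : hom X Y),
    comp h (comp g f) = comp (comp h g) f
}.

Arguments hom {c} X Y.
Arguments idn {c} X.
Arguments comp {c X Y Z} g f.

Notation "g ∘ f" := (comp g f) (at level 40, left associativity) : cat_scope.

Definition is_iso (C : category) (X Y : C) (f : hom X Y) : Prop :=
  exists g : hom Y X, g ∘ f = idn X /\ f ∘ g = idn Y.

Definition isomorphic (C : category) (X Y : C) : Prop :=
  exists f : hom X Y, is_iso f.

Definition eq_hom (C : category) (X Y : C) (e : X = Y) : hom X Y :=
  match e in _ = Y' return hom X Y' with eq_refl => idn X end.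

Record functor (C D : category) := Functor {
  fob :> C -> D;
  fmap : forall X Y : C, hom X Y -> hom (fob X) (fob Y);
  fmap_id : forall X, fmap (idn X) = idn (fob X);
  fmap_comp : forall X Y Z (g : hom Y Z) (f : hom X Y),
    fmap (g ∘ f) = fmap g ∘ fmap f
}.

Arguments fmap {C D} _ {X Y} _.

Record adjunction (C D : category) (L : functor C D) (R : functor D C) :=
  Adjunction {
  eta : forall X : C, hom X (R (L X));
  eps : forall Y : D, hom (L (R Y)) Y;
  eta_natural : forall (X X' : C) (f : hom X X'),
    eta X' ∘ f = fmap R (fmap L f) ∘ eta X;
  eps_natural : forall (Y Y' : D) (g : hom Y Y'),
    eps Y' ∘ fmap L (fmap R g) = g ∘ eps Y;
  triangle_left : forall X, eps (L X) ∘ fmap L (eta X) = idn (L X);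
  triangle_right : forall Y, fmap R (eps Y) ∘ eta (R Y) = idn (R Y)
}.

Record left_adjoint (C D : category) (R : functor D C) := LeftAdjoint {
  ladj :> functor C D;
  ladj_adjunction : adjunction ladj R
}.

Record right_adjoint (C D : category) (L : functor C D) := RightAdjoint {
  radj :> functor D C;
  radj_adjunction : adjunction L radj
}.

(** An arbitrary product diagram [I <- P -> X], not only a chosen one: a
    "projection" is the leg [pr1] of such a diagram. *)
Record product (B : category) (I X : B) := Product {
  apex :> B;
  pr1 : hom apex I;
  pr2 : hom apex X;
  pairing : forall Z, hom Z I -> hom Z X -> hom Z apex;
  pr1_pairing : forall Z (f : hom Z I) (g : hom Z X), pr1 ∘ pairing f g = f;
  pr2_pairing : forall Z (f : hom Z I) (g : hom Z X), pr2 ∘ pairing f g = g;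
  pairing_unique : forall Z (f : hom Z I) (g : hom Z X) (h : hom Z apex),
    pr1 ∘ h = f -> pr2 ∘ h = g -> h = pairing f g
}.

Arguments pr1 {B I X} p.
Arguments pr2 {B I X} p.
Arguments pairing {B I X} p {Z} f g.

Definition times_id (B : category) (I J X : B) (P : product I X)
    (Q : product J X) (f : hom I J) : hom P Q :=
  pairing Q (f ∘ pr1 P) (pr2 P).

Record fp_category := FPCategory {
  fp_cat :> category;
  terminal : fp_cat;
  bang : forall X : fp_cat, hom X terminal;
  bang_unique : forall (X : fp_cat) (f : hom X terminal), f = bang X;
  bprod : forall I X : fp_cat, product I X
}.

Arguments bprod {_} I X.

Notation "I × X" := (bprod I X) (at level 40, left associativity) : cat_scope.
Notation "⟨ f , g ⟩" := (pairing (bprod _ _) f g) : cat_scope.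

Record exponential (B : fp_category) (A Y : B) := Exponential {
  exp_ob : B;
  ev : hom (A × exp_ob) Y;
  curry : forall C : B, hom (A × C) Y -> hom C exp_ob;
  ev_curry : forall (C : B) (f : hom (A × C) Y),
    ev ∘ ⟨pr1 (A × C), curry f ∘ pr2 (A × C)⟩ = f;
  curry_unique : forall (C : B) (f : hom (A × C) Y) (g : hom C exp_ob),
    ev ∘ ⟨pr1 (A × C), g ∘ pr2 (A × C)⟩ = f -> g = curry f
}.

Definition cartesian_closed (B : fp_category) := forall A Y : B, exponential A Y.

(** Ternary products [A1 × A2 × A3] are [(A1 × A2) × A3]. *)
Section Triple.
Variables (B : fp_category) (A1 A2 A3 : B).

Definition tpr1 : hom (A1 × A2 × A3) A1 := pr1 (A1 × A2) ∘ pr1 (A1 × A2 × A3).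
Definition tpr2 : hom (A1 × A2 × A3) A2 := pr2 (A1 × A2) ∘ pr1 (A1 × A2 × A3).
Definition tpr3 : hom (A1 × A2 × A3) A3 := pr2 (A1 × A2 × A3).

Lemma pairing_comp (I X : B) (P : product I X) (Z W : B) (f : hom Z I)
  (g : hom Z X) (k : hom W Z) : pairing P f g ∘ k = pairing P (f ∘ k) (g ∘ k).
Proof.
  apply pairing_unique.
  - now rewrite comp_assoc, pr1_pairing.
  - now rewrite comp_assoc, pr2_pairing.
Qed.

Lemma triple_ext (Z : B) (h k : hom Z (A1 × A2 × A3)) :
  tpr1 ∘ h = tpr1 ∘ k -> tpr2 ∘ h = tpr2 ∘ k -> tpr3 ∘ h = tpr3 ∘ k -> h = k.
Proof.
  unfold tpr1, tpr2, tpr3; rewrite <- !comp_assoc; intros e1 e2 e3.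
  rewrite (pairing_unique (p := A1 × A2 × A3) (h := k) eq_refl eq_refl).
  apply pairing_unique; [| exact e3].
  rewrite (pairing_unique (p := A1 × A2) (h := pr1 _ ∘ k) eq_refl eq_refl).
  now apply pairing_unique.
Qed.

Lemma tpr1_pairing (Z : B) (f : hom Z A1) (g : hom Z A2) (h : hom Z A3) :
  tpr1 ∘ ⟨⟨f, g⟩, h⟩ = f.
Proof. unfold tpr1. now rewrite <- comp_assoc, !pr1_pairing. Qed.

Lemma tpr2_pairing (Z : B) (f : hom Z A1) (g : hom Z A2) (h : hom Z A3) :
  tpr2 ∘ ⟨⟨f, g⟩, h⟩ = g.
Proof. unfold tpr2. now rewrite <- comp_assoc, pr1_pairing, pr2_pairing. Qed.

Lemma tpr3_pairing (Z : B) (f : hom Z A1) (g : hom Z A2) (h : hom Z A3) :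
  tpr3 ∘ ⟨⟨f, g⟩, h⟩ = h.
Proof. unfold tpr3. now rewrite pr2_pairing. Qed.

(** [⟨π1, π2⟩ : A1 × A2 × A3 -> A1 × A2] is a projection, with complementary
    projection [π3]. *)
Definition proj12 : product (A1 × A2) A3.
Proof.
  refine (@Product _ (A1 × A2) A3 (A1 × A2 × A3) ⟨tpr1, tpr2⟩ tpr3
    (fun Z f g => ⟨⟨pr1 (A1 × A2) ∘ f, pr2 (A1 × A2) ∘ f⟩, g⟩) _ _ _).
  - intros Z f g.
    rewrite pairing_comp, tpr1_pairing, tpr2_pairing.
    symmetry; now apply pairing_unique.
  - intros Z f g; apply tpr3_pairing.
  - intros Z f g h <- <-; apply triple_ext;
      rewrite ?tpr1_pairing, ?tpr2_pairing, ?tpr3_pairing, ?comp_assoc,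
        ?pr1_pairing, ?pr2_pairing; reflexivity.
Defined.

(** [⟨π1, π3⟩ : A1 × A2 × A3 -> A1 × A3] is a projection, with complementary
    projection [π2]. *)
Definition proj13 : product (A1 × A3) A2.
Proof.
  refine (@Product _ (A1 × A3) A2 (A1 × A2 × A3) ⟨tpr1, tpr3⟩ tpr2
    (fun Z f g => ⟨⟨pr1 (A1 × A3) ∘ f, g⟩, pr2 (A1 × A3) ∘ f⟩) _ _ _).
  - intros Z f g.
    rewrite pairing_comp, tpr1_pairing, tpr3_pairing.
    symmetry; now apply pairing_unique.
  - intros Z f g; apply tpr2_pairing.
  - intros Z f g h <- <-; apply triple_ext;
      rewrite ?tpr1_pairing, ?tpr2_pairing, ?tpr3_pairing, ?comp_assoc,
        ?pr1_pairing, ?pr2_pairing; reflexivity.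
Defined.

End Triple.

Arguments tpr1 {B} A1 A2 A3.
Arguments tpr2 {B} A1 A2 A3.
Arguments tpr3 {B} A1 A2 A3.
Arguments proj12 {B} A1 A2 A3.
Arguments proj13 {B} A1 A2 A3.

Section Fibres.
Variables (E B : category) (p : functor E B).

Record fibre_ob (I : B) := FibreOb {
  total : E;
  total_over : p total = I
}.

Lemma fibre_ob_eq (I : B) (X Y : fibre_ob I) : total X = total Y -> X = Y.
Proof.
  destruct X as [X eX], Y as [Y eY]; simpl; intros <-.
  f_equal; apply proof_irrelevance.
Qed.

Definition cast_hom (I I' J J' : B) (e : I = I') (e' : J = J') (u : hom I J) :
    hom I' J' :=
  match e in _ = K, e' in _ = K' return hom K K' with
  | eq_refl, eq_refl => u
  end.

(** [p f = u], modulo the identifications [p X = I] and [p Y = J]. *)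
Definition lies_over (I J : B) (u : hom I J) (X : fibre_ob I) (Y : fibre_ob J)
    (f : hom (total X) (total Y)) : Prop :=
  cast_hom (total_over X) (total_over Y) (fmap p f) = u.

Lemma lies_over_idn (I : B) (X : fibre_ob I) :
  lies_over (idn I) (X := X) (Y := X) (idn (total X)).
Proof. destruct X as [X []]; apply fmap_id. Qed.

Lemma lies_over_comp (I J K : B) (v : hom J K) (u : hom I J) (X : fibre_ob I)
    (Y : fibre_ob J) (Z : fibre_ob K) (g : hom (total Y) (total Z))
    (f : hom (total X) (total Y)) :
  lies_over v g -> lies_over u f -> lies_over (v ∘ u) (g ∘ f).
Proof.
  revert v u g f; destruct X as [X []], Y as [Y []], Z as [Z []].
  unfold lies_over; simpl; intros v u g f <- <-; apply fmap_comp.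
Qed.

Record vertical (I : B) (X Y : fibre_ob I) := Vertical {
  arrow : hom (total X) (total Y);
  arrow_over : lies_over (idn I) arrow
}.

Lemma vertical_eq (I : B) (X Y : fibre_ob I) (f g : vertical X Y) :
  arrow f = arrow g -> f = g.
Proof.
  destruct f as [f ef], g as [g eg]; simpl; intros <-.
  f_equal; apply proof_irrelevance.
Qed.

Definition vertical_id (I : B) (X : fibre_ob I) : vertical X X :=
  Vertical (lies_over_idn X).

Definition vertical_comp (I : B) (X Y Z : fibre_ob I) (g : vertical Y Z)
    (f : vertical X Y) : vertical X Z.
Proof.
  refine (@Vertical I X Z (arrow g ∘ arrow f) _).
  rewrite <- (comp_idl (idn I)).
  exact (lies_over_comp (arrow_over g) (arrow_over f)).
Defined.

Definition fibre (I : B) : category.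
Proof.
  refine (@Category (fibre_ob I) (@vertical I) (@vertical_id I)
            (@vertical_comp I) _ _ _); intros; apply vertical_eq; simpl.
  - apply comp_idl.
  - apply comp_idr.
  - apply comp_assoc.
Defined.

Record cartesian (X Y : E) (f : hom X Y) := Cartesian {
  factor : forall (Z : E) (g : hom Z Y) (w : hom (p Z) (p X)),
    fmap p f ∘ w = fmap p g -> hom Z X;
  factor_over : forall Z g w (e : fmap p f ∘ w = fmap p g),
    fmap p (@factor Z g w e) = w;
  factor_comp : forall Z g w (e : fmap p f ∘ w = fmap p g),
    f ∘ @factor Z g w e = g;
  factor_unique : forall Z g w (e : fmap p f ∘ w = fmap p g) (h : hom Z X),
    fmap p h = w -> f ∘ h = g -> h = @factor Z g w e
}.

Record cleavage := Cleavage {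
  pull : forall (I J : B), hom I J -> fibre_ob J -> fibre_ob I;
  lift : forall (I J : B) (u : hom I J) (Y : fibre_ob J),
    hom (total (pull u Y)) (total Y);
  lift_over : forall (I J : B) (u : hom I J) (Y : fibre_ob J),
    lies_over u (lift u Y);
  lift_cartesian : forall (I J : B) (u : hom I J) (Y : fibre_ob J),
    cartesian (lift u Y)
}.

(** Equality of arrows with codomain [Y], as pairs of a domain and an arrow. *)
Definition into (Y X : E) (f : hom X Y) : {X : E & hom X Y} :=
  existT (fun X => hom X Y) X f.

Definition split (c : cleavage) : Prop :=
  (forall (I : B) (Y : fibre_ob I),
     into (lift c (idn I) Y) = into (idn (total Y))) /\
  (forall (I J K : B) (v : hom J K) (u : hom I J) (Z : fibre_ob K),
     into (lift c (v ∘ u) Z) = into (lift c v Z ∘ lift c u (pull c v Z))).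

End Fibres.

Record split_fibration (E B : category) := SplitFibration {
  fib_functor :> functor E B;
  fib_cleavage : cleavage fib_functor;
  fib_split : split fib_cleavage
}.

Section Reindexing.
Variables (E B : category) (p : split_fibration E B).
Local Notation c := (fib_cleavage p).

Lemma lift_triangle (I J K : B) (u : hom J K) (v : hom I J) (Z : fibre_ob p I)
    (Y : fibre_ob p K) (g : hom (total Z) (total Y)) :
  lies_over (u ∘ v) g ->
  fmap p (lift c u Y)
    ∘ cast_hom (eq_sym (total_over Z)) (eq_sym (total_over (pull c u Y))) v
  = fmap p g.
Proof.
  generalize (lift_over c u Y); generalize (lift c u Y).
  generalize (pull c u Y); intros X; revert u v g.
  destruct X as [X []], Y as [Y []], Z as [Z []].
  unfold lies_over; simpl; intros u v g f <- ->; reflexivity.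
Qed.

Lemma cast_lies_over (I J : B) (v : hom I J) (Z : fibre_ob p I)
    (X : fibre_ob p J) (h : hom (total Z) (total X)) :
  fmap p h = cast_hom (eq_sym (total_over Z)) (eq_sym (total_over X)) v
  <-> lies_over v h.
Proof.
  revert v h; destruct Z as [Z []], X as [X []]; unfold lies_over; simpl; tauto.
Qed.

Definition lift_factor (I J K : B) (u : hom J K) (v : hom I J)
    (Z : fibre_ob p I) (Y : fibre_ob p K) (g : hom (total Z) (total Y))
    (H : lies_over (u ∘ v) g) : hom (total Z) (total (pull c u Y)) :=
  factor (lift_cartesian c u Y) (lift_triangle H).

Lemma lift_factor_over (I J K : B) (u : hom J K) (v : hom I J)
    (Z : fibre_ob p I) (Y : fibre_ob p K) (g : hom (total Z) (total Y))
    (H : lies_over (u ∘ v) g) : lies_over v (lift_factor H).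
Proof. apply cast_lies_over, factor_over. Qed.

Lemma lift_factor_comp (I J K : B) (u : hom J K) (v : hom I J)
    (Z : fibre_ob p I) (Y : fibre_ob p K) (g : hom (total Z) (total Y))
    (H : lies_over (u ∘ v) g) : lift c u Y ∘ lift_factor H = g.
Proof. apply factor_comp. Qed.

Lemma lift_factor_unique (I J K : B) (u : hom J K) (v : hom I J)
    (Z : fibre_ob p I) (Y : fibre_ob p K) (g : hom (total Z) (total Y))
    (H : lies_over (u ∘ v) g) (h : hom (total Z) (total (pull c u Y))) :
  lies_over v h -> lift c u Y ∘ h = g -> h = lift_factor H.
Proof.
  intros Hv Hg; apply factor_unique; [now apply cast_lies_over | exact Hg].
Qed.

Lemma vertical_lift_over (I J : B) (u : hom I J) (X Y : fibre_ob p J)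
    (k : vertical X Y) : lies_over (u ∘ idn I) (arrow k ∘ lift c u X).
Proof.
  replace (u ∘ idn I) with (idn J ∘ u) by now rewrite comp_idl, comp_idr.
  exact (lies_over_comp (arrow_over k) (lift_over c u X)).
Qed.

Definition pull_map (I J : B) (u : hom I J) (X Y : fibre_ob p J)
    (k : vertical X Y) : vertical (pull c u X) (pull c u Y) :=
  Vertical (lift_factor_over (vertical_lift_over u k)).

Definition reindex (I J : B) (u : hom I J) : functor (fibre p J) (fibre p I).
Proof.
  refine (@Functor (fibre p J) (fibre p I) (pull c u) (@pull_map I J u) _ _).
  - intros X; apply vertical_eq; symmetry; apply lift_factor_unique.
    + apply lies_over_idn.
    + simpl; now rewrite comp_idl, comp_idr.
  - intros X Y Z g f; apply vertical_eq; symmetry; apply lift_factor_unique.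
    + apply arrow_over.
    + simpl; now rewrite comp_assoc, lift_factor_comp, <- comp_assoc,
        lift_factor_comp, comp_assoc.
Defined.

Lemma reindex_id (I : B) (X : fibre p I) : reindex (idn I) X = X.
Proof.
  apply fibre_ob_eq.
  exact (f_equal (@projT1 _ _) (proj1 (fib_split p) I X)).
Qed.

Lemma reindex_comp (I J K : B) (v : hom J K) (u : hom I J) (X : fibre p K) :
  reindex (v ∘ u) X = reindex u (reindex v X).
Proof.
  apply fibre_ob_eq.
  exact (f_equal (@projT1 _ _) (proj2 (fib_split p) I J K v u X)).
Qed.

Lemma reindex_square (I J J' K : B) (u : hom I J) (v : hom J K) (u' : hom I J')
    (v' : hom J' K) : v ∘ u = v' ∘ u' ->
  forall X : fibre p K, reindex u (reindex v X) = reindex u' (reindex v' X).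
Proof. intros e X; now rewrite <- !reindex_comp, e. Qed.

Lemma reindex_section (I J : B) (s : hom I J) (r : hom J I) :
  r ∘ s = idn I -> forall X : fibre p I, reindex s (reindex r X) = X.
Proof. intros e X; now rewrite <- reindex_comp, e, reindex_id. Qed.

End Reindexing.

Arguments reindex {E B} p {I J} u.

Section Simple.
Variables (E : category) (B : fp_category) (p : split_fibration E B).

Lemma times_id_square (I J X : B) (P : product I X) (Q : product J X)
    (f : hom I J) : pr1 Q ∘ times_id P Q f = f ∘ pr1 P.
Proof. apply pr1_pairing. Qed.

(** The transpose of [(f×1)^* η : (f×1)^* β -> (f×1)^* π_J^* ∐ β] along
    [∐ ⊣ π_I^*], where [(f×1)^* π_J^* = π_I^* f^*] since [p] is split. *)
Definition coproduct_bc
    (coprod : forall (I X : B) (P : product I X), left_adjoint (reindex p (pr1 P)))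
    (I J X : B) (P : product I X) (Q : product J X) (f : hom I J)
    (b : fibre p Q) :
    hom (coprod I X P (reindex p (times_id P Q f) b))
        (reindex p f (coprod J X Q b)) :=
  eps (ladj_adjunction (coprod I X P)) _
    ∘ fmap (coprod I X P)
        (eq_hom (reindex_square (times_id_square P Q f) (coprod J X Q b))
           ∘ fmap (reindex p (times_id P Q f))
               (eta (ladj_adjunction (coprod J X Q)) b)).

Record simple_coproducts := SimpleCoproducts {
  scoprod :> forall (I X : B) (P : product I X), left_adjoint (reindex p (pr1 P));
  scoprod_bc : forall (I J X : B) (P : product I X) (Q : product J X)
    (f : hom I J) (b : fibre p Q), is_iso (coproduct_bc scoprod P f b)
}.

Definition product_bc
    (prd : forall (I X : B) (P : product I X), right_adjoint (reindex p (pr1 P)))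
    (I J X : B) (P : product I X) (Q : product J X) (f : hom I J)
    (b : fibre p Q) :
    hom (reindex p f (prd J X Q b))
        (prd I X P (reindex p (times_id P Q f) b)) :=
  fmap (prd I X P)
    (fmap (reindex p (times_id P Q f)) (eps (radj_adjunction (prd J X Q)) b)
       ∘ eq_hom (eq_sym (reindex_square (times_id_square P Q f) (prd J X Q b))))
    ∘ eta (radj_adjunction (prd I X P)) _.

Record simple_products := SimpleProducts {
  sprod :> forall (I X : B) (P : product I X), right_adjoint (reindex p (pr1 P));
  sprod_bc : forall (I J X : B) (P : product I X) (Q : product J X)
    (f : hom I J) (b : fibre p Q), is_iso (product_bc sprod P f b)
}.

Definition graph (A X : B) (P : product A X) (g : hom A X) : hom A P :=
  pairing P (idn A) g.

Lemma graph_section (A X : B) (P : product A X) (g : hom A X) :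
  pr1 P ∘ graph P g = idn A.
Proof. apply pr1_pairing. Qed.

(** [⟨1, g⟩^* η : ⟨1, g⟩^* β -> ⟨1, g⟩^* π_A^* ∐ β = ∐ β]. *)
Definition graph_eta (S : simple_coproducts) (A X : B) (P : product A X)
    (b : fibre p P) (g : hom A X) :
    hom (reindex p (graph P g) b) (S A X P b) :=
  eq_hom (reindex_section (graph_section P g) (S A X P b))
    ∘ fmap (reindex p (graph P g)) (eta (ladj_adjunction (S A X P)) b).

Definition coprod_quantifier_free (S : simple_coproducts) (I : B)
    (a : fibre p I) : Prop :=
  forall (A X : B) (f : hom A I) (P : product A X) (b : fibre p P)
    (h : hom (reindex p f a) (S A X P b)),
  exists! gh : {g : hom A X & hom (reindex p f a) (reindex p (graph P g) b)},
    h = graph_eta S b (projT1 gh) ∘ projT2 gh.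

Definition enough_quantifier_free (S : simple_coproducts) : Prop :=
  forall (I : B) (a : fibre p I),
  exists (A : B) (b : fibre p (I × A)),
    coprod_quantifier_free S b /\ isomorphic a (S I A (I × A) b).

Record skolem_fibration := SkolemFibration {
  sk_closed : cartesian_closed B;
  sk_prod : simple_products;
  sk_coprod : simple_coproducts;
  sk_enough : enough_quantifier_free sk_coprod;
  sk_prod_free : forall (I X : B) (P : product I X) (a : fibre p P),
    coprod_quantifier_free sk_coprod a ->
    coprod_quantifier_free sk_coprod (sk_prod I X P a)
}.

End Simple.

Definition power (E : category) (B : fp_category) (p : split_fibration E B)
    (S : skolem_fibration p) (Y A : B) : B := exp_ob (sk_closed S A Y).

Definition evaluation (E : category) (B : fp_category) (p : split_fibration E B)
    (S : skolem_fibration p) (Y A : B) : hom (A × power S Y A) Y :=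
  ev (sk_closed S A Y).

Definition Forall (E : category) (B : fp_category) (p : split_fibration E B)
    (S : skolem_fibration p) (I X : B) (P : product I X) (a : fibre p P) :
    fibre p I := sk_prod S I X P a.

Definition Exists (E : category) (B : fp_category) (p : split_fibration E B)
    (S : skolem_fibration p) (I X : B) (P : product I X) (a : fibre p P) :
    fibre p I := sk_coprod S I X P a.

Arguments Forall {E B p} S {I X} P a.
Arguments Exists {E B p} S {I X} P a.

(* Main.v *)
From Stdlib Require Import ProofIrrelevance.
Require Import Defs.

Set Implicit Arguments.
Unset Strict Implicit.
Unset Printing Implicit Defensive.

(** Skolemization holds because quantifier-free objects detect isomorphisms and
    see an existential quantifier as the choice of a witness.

    All arguments take place in the total category [E], where arrows over
    arbitrary base arrows avoid most transports along identities between
    reindexed objects.  There the unit of [∐_P ⊣ π^*] becomes an arrow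
    [coinj b : b -> ∐_P b] over the projection, and quantifier-freeness of [G]
    gives: every arrow [G -> ∐_P b] factors uniquely through [coinj b]
    ([free_lifts_coinj]).  The base component of the factorization is the
    witness.  Conversely, if there are enough quantifier-free objects, an arrow
    [b -> L] over the projection of [P] through which arrows from
    quantifier-free objects factor uniquely exhibits [L] as [∐_P b]
    ([coprod_iso_of_lifts]).

    It remains to find such an arrow from [∏_x α(i,x,f x)] to [∏_x ∐_y α].
    Arrows from [G], over [C], into a product [∏_x b] correspond to arrows
    [π^* G -> b], over [u × 1] if the former lie over [u]; this is the
    adjunction together with Beck-Chevalley ([transposes]).  The arrow wanted is
    the transpose of the composite of the instantiation
    [π^* ∏_x α(i,x,f x) -> α(i,x,f x)], the cartesian arrow into [α] and
    [coinj α].  If [G] is quantifier-free, so is [π^* G], hence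

    - an arrow [G -> ∏_x ∐_y α] is an arrow [π^* G -> ∐_y α], hence an arrow
      [π^* G -> α] over some [g : C × A2 -> A1 × A2 × Y] whose first two
      components are prescribed;
    - an arrow [G -> ∏_x α(i,x,f x)] over [(u, w)] is an arrow [π^* G -> α] over
      [(c, x) |-> (u c, x, ev (x, w c))].

    These data agree, since by cartesian closure the third component of [g] is
    [ev (x, w c)] for exactly one [w] ([skolem_function_exists],
    [skolem_function_unique]), and so [choice_lifts] holds. *)

(** * Unique liftings and cartesian arrows *)

Definition lifts_uniquely (C : category) (X Y : C) (f : hom X Y) (G : C) : Prop :=
  forall h : hom G Y, exists! k : hom G X, f ∘ k = h.

Section Total.
Variables (E B : category) (p : split_fibration E B).

Definition cart (I J : B) (u : hom I J) (Y : fibre p J) :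
    hom (total (reindex p u Y)) (total Y) :=
  lift (fib_cleavage p) u Y.

Lemma cart_over (I J : B) (u : hom I J) (Y : fibre p J) : lies_over u (cart u Y).
Proof. apply lift_over. Qed.

Lemma over_exists (I J : B) (X : fibre p I) (Y : fibre p J)
    (f : hom (total X) (total Y)) : exists u, lies_over u f.
Proof. eexists; reflexivity. Qed.

Lemma over_unique (I J : B) (X : fibre p I) (Y : fibre p J)
    (f : hom (total X) (total Y)) (u v : hom I J) :
  lies_over u f -> lies_over v f -> u = v.
Proof. unfold lies_over; congruence. Qed.

Lemma cart_exists (I J K : B) (u : hom J K) (v : hom I J) (Z : fibre p I)
    (Y : fibre p K) (g : hom (total Z) (total Y)) :
  lies_over (u ∘ v) g ->
  exists k : hom (total Z) (total (reindex p u Y)),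
    lies_over v k /\ cart u Y ∘ k = g.
Proof.
  intros H; exists (lift_factor H); split;
    [apply lift_factor_over | apply lift_factor_comp].
Qed.

(** The base arrow [v] must be common to [a] and [b]: cartesianness cancels the
    lift only among arrows over the same base arrow. *)
Lemma cart_ext (I J K : B) (u : hom J K) (v : hom I J) (Z : fibre p I)
    (Y : fibre p K) (a b : hom (total Z) (total (reindex p u Y))) :
  lies_over v a -> lies_over v b -> cart u Y ∘ a = cart u Y ∘ b -> a = b.
Proof.
  intros Ha Hb e.
  pose proof (lies_over_comp (cart_over u Y) Hb) as H.
  transitivity (lift_factor H); [| symmetry];
    apply lift_factor_unique; trivial.
Qed.

Lemma arrow_comp (I : B) (X Y Z : fibre p I) (g : hom Y Z) (f : hom X Y) :
  arrow (g ∘ f) = arrow g ∘ arrow f.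
Proof. reflexivity. Qed.

Lemma over_vertical_l (I J : B) (u : hom I J) (X : fibre p I) (Y Y' : fibre p J)
    (g : hom Y Y') (f : hom (total X) (total Y)) :
  lies_over u f -> lies_over u (arrow g ∘ f).
Proof.
  intros H; rewrite <- (comp_idl u); exact (lies_over_comp (arrow_over g) H).
Qed.

Lemma over_vertical_r (I J : B) (u : hom I J) (X X' : fibre p I) (Y : fibre p J)
    (f : hom (total X) (total Y)) (g : hom X' X) :
  lies_over u f -> lies_over u (f ∘ arrow g).
Proof.
  intros H; rewrite <- (comp_idr u); exact (lies_over_comp H (arrow_over g)).
Qed.

Lemma over_vertical_cancel (I J : B) (u : hom I J) (X : fibre p I)
    (Y Y' : fibre p J) (g : hom Y Y') (f : hom (total X) (total Y)) :
  lies_over u (arrow g ∘ f) -> lies_over u f.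
Proof.
  intros H; destruct (over_exists f) as [v Hv].
  now rewrite (over_unique H (over_vertical_l g Hv)).
Qed.

Lemma vertical_cart_exists (I J : B) (u : hom I J) (Z : fibre p I)
    (Y : fibre p J) (g : hom (total Z) (total Y)) :
  lies_over u g -> exists k : hom Z (reindex p u Y), cart u Y ∘ arrow k = g.
Proof.
  intros H; rewrite <- (comp_idr u) in H.
  destruct (cart_exists H) as (k & Hk & e).
  now exists (Vertical Hk).
Qed.

Lemma vertical_cart_ext (I J : B) (u : hom I J) (Z : fibre p I)
    (Y : fibre p J) (a b : hom Z (reindex p u Y)) :
  cart u Y ∘ arrow a = cart u Y ∘ arrow b -> a = b.
Proof.
  intros e; apply vertical_eq; exact (cart_ext (arrow_over a) (arrow_over b) e).
Qed.

Lemma cart_natural (I J : B) (u : hom I J) (X Y : fibre p J) (k : hom X Y) :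
  cart u Y ∘ arrow (fmap (reindex p u) k) = arrow k ∘ cart u X.
Proof. apply lift_factor_comp. Qed.

(** Splitness equates arrows together with their domains; this turns such an
    equation into an equation of arrows with the transport made explicit. *)
Lemma into_eq_hom (I : B) (X X' : fibre p I) (e : X = X') (Z : E)
    (f : hom (total X) Z) (f' : hom (total X') Z) :
  into f = into f' -> f' ∘ arrow (eq_hom e) = f.
Proof.
  destruct e; simpl; intros e; rewrite comp_idr.
  now apply inj_pair2 in e.
Qed.

Lemma cart_comp_into (I J K : B) (v : hom J K) (u : hom I J) (X : fibre p K) :
  into (cart (v ∘ u) X) = into (cart v X ∘ cart u (reindex p v X)).
Proof. apply (proj2 (fib_split p)). Qed.

(** The identification of the two iterated reindexings is the one compatible
    with the cartesian arrows.  The Beck-Chevalley arrows are built from this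
    identification. *)
Lemma cart_square (I J J' K : B) (u : hom I J) (v : hom J K) (u' : hom I J')
    (v' : hom J' K) (e : v ∘ u = v' ∘ u') (X : fibre p K) :
  cart v' X ∘ cart u' (reindex p v' X) ∘ arrow (eq_hom (reindex_square e X))
  = cart v X ∘ cart u (reindex p v X).
Proof.
  apply into_eq_hom.
  now rewrite <- !cart_comp_into, e.
Qed.

Lemma cart_section (I J : B) (s : hom I J) (r : hom J I) (e : r ∘ s = idn I)
    (X : fibre p I) :
  arrow (eq_hom (reindex_section e X)) = cart r X ∘ cart s (reindex p r X).
Proof.
  rewrite <- (comp_idl (arrow _)); apply into_eq_hom.
  rewrite <- cart_comp_into, e; apply (proj1 (fib_split p)).
Qed.

Lemma eq_hom_sym (C : category) (X Y : C) (e : X = Y) :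
  eq_hom e ∘ eq_hom (eq_sym e) = idn Y.
Proof. destruct e; apply comp_idl. Qed.

Lemma cart_square_sym (I J J' K : B) (u : hom I J) (v : hom J K) (u' : hom I J')
    (v' : hom J' K) (e : v ∘ u = v' ∘ u') (X : fibre p K) :
  cart v X ∘ cart u (reindex p v X) ∘ arrow (eq_hom (eq_sym (reindex_square e X)))
  = cart v' X ∘ cart u' (reindex p v' X).
Proof.
  rewrite <- (cart_square e), <- comp_assoc.
  rewrite <- arrow_comp, eq_hom_sym; apply comp_idr.
Qed.

End Total.

Section Quantifiers.
Variables (E : category) (B : fp_category) (p : split_fibration E B).

(** * Products with a fixed factor *)

Lemma product_ext (I X : B) (P : product I X) (Z : B) (a b : hom Z P) :
  pr1 P ∘ a = pr1 P ∘ b -> pr2 P ∘ a = pr2 P ∘ b -> a = b.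
Proof.
  intros e1 e2; rewrite (pairing_unique (h := b) eq_refl eq_refl).
  now apply pairing_unique.
Qed.

Lemma times_id_comp (I J K X : B) (P : product I X) (Q : product J X)
    (R : product K X) (f : hom I J) (g : hom J K) :
  times_id Q R g ∘ times_id P Q f = times_id P R (g ∘ f).
Proof.
  unfold times_id; rewrite pairing_comp.
  now rewrite <- comp_assoc, pr1_pairing, pr2_pairing, comp_assoc.
Qed.

(** * Simple coproducts *)

Section Coproducts.
Variable S : simple_coproducts p.

(** The unit of [∐_P ⊣ π^*] as an arrow of the total category. *)
Definition coinj (I X : B) (P : product I X) (b : fibre p P) :
    hom (total b) (total (S I X P b)) :=
  cart (pr1 P) (S I X P b) ∘ arrow (eta (ladj_adjunction (S I X P)) b).

Lemma coinj_over (I X : B) (P : product I X) (b : fibre p P) :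
  lies_over (pr1 P) (coinj b).
Proof. apply over_vertical_r, cart_over. Qed.

Lemma coprod_desc (I X : B) (P : product I X) (b : fibre p P) (Z : fibre p I)
    (f : hom (total b) (total Z)) :
  lies_over (pr1 P) f ->
  exists g : hom (S I X P b) Z, arrow g ∘ coinj b = f.
Proof.
  intros H; destruct (vertical_cart_exists H) as [k <-].
  set (ad := ladj_adjunction (S I X P)).
  exists (eps ad Z ∘ fmap (S I X P) k).
  unfold coinj; rewrite comp_assoc, <- cart_natural, <- comp_assoc.
  rewrite <- arrow_comp; do 2 f_equal.
  now rewrite fmap_comp, <- comp_assoc, <- (eta_natural ad), comp_assoc,
    (triangle_right ad), comp_idl.
Qed.

Lemma coprod_ext (I X : B) (P : product I X) (b : fibre p P) (Z : fibre p I)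
    (g g' : hom (S I X P b) Z) :
  arrow g ∘ coinj b = arrow g' ∘ coinj b -> g = g'.
Proof.
  set (ad := ladj_adjunction (S I X P)).
  unfold coinj; rewrite !comp_assoc, <- !cart_natural, <- !comp_assoc.
  intros e.
  apply (vertical_cart_ext
    (a := fmap (reindex p (pr1 P)) g ∘ eta ad b)
    (b := fmap (reindex p (pr1 P)) g' ∘ eta ad b)) in e.
  assert (H : forall k : hom (S I X P b) Z,
    k = eps ad Z ∘ fmap (S I X P) (fmap (reindex p (pr1 P)) k ∘ eta ad b)).
  { intros k; rewrite fmap_comp, comp_assoc, (eps_natural ad), <- comp_assoc,
      (triangle_left ad); symmetry; apply comp_idr. }
  now rewrite (H g), (H g'), e.
Qed.

(** Beck-Chevalley says that this arrow is again cartesian, so that every arrow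
    into [∐_Q b] over [u] comes from a vertical arrow into a coproduct over [I],
    where quantifier-freeness applies. *)
Definition cobase (I J X : B) (P : product I X) (Q : product J X) (u : hom I J)
    (b : fibre p Q) :
    hom (total (S I X P (reindex p (times_id P Q u) b))) (total (S J X Q b)) :=
  cart u (S J X Q b) ∘ arrow (coproduct_bc S P u b).

(** The vertical part of [cobase] is by construction a transpose along
    [∐_P ⊣ π^*]; composing with the unit undoes the transposition. *)
Lemma cobase_coinj (I J X : B) (P : product I X) (Q : product J X) (u : hom I J)
    (b : fibre p Q) :
  cobase P u b ∘ coinj (reindex p (times_id P Q u) b)
  = coinj b ∘ cart (times_id P Q u) b.
Proof.
  set (s := times_id P Q u).
  set (ad := ladj_adjunction (S I X P)).
  set (ad' := ladj_adjunction (S J X Q)).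
  set (k := eq_hom (reindex_square (times_id_square P Q u) (S J X Q b))
              ∘ fmap (reindex p s) (eta ad' b)).
  assert (H : fmap (reindex p (pr1 P)) (coproduct_bc S P u b)
                ∘ eta ad (reindex p s b) = k).
  { unfold coproduct_bc; fold ad ad' s k.
    now rewrite fmap_comp, <- comp_assoc, <- (eta_natural ad), comp_assoc,
      (triangle_right ad), comp_idl. }
  unfold cobase, coinj.
  transitivity (cart u (S J X Q b)
    ∘ (cart (pr1 P) (reindex p u (S J X Q b)) ∘ arrow k)).
  - rewrite <- H, arrow_comp, <- !comp_assoc; f_equal.
    rewrite !comp_assoc; f_equal.
    symmetry; apply (cart_natural (pr1 P)).
  - unfold k; rewrite arrow_comp, !comp_assoc, cart_square, <- !comp_assoc; f_equal.
    apply cart_natural.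
Qed.

Lemma cobase_exists (I J X : B) (P : product I X) (Q : product J X) (u : hom I J)
    (b : fibre p Q) (G : fibre p I) (h : hom (total G) (total (S J X Q b))) :
  lies_over u h ->
  exists k : hom G (S I X P (reindex p (times_id P Q u) b)),
    cobase P u b ∘ arrow k = h.
Proof.
  intros H; destruct (vertical_cart_exists H) as [k <-].
  destruct (scoprod_bc S P u b) as (i & _ & e).
  exists (i ∘ k); unfold cobase; rewrite <- comp_assoc; f_equal.
  now rewrite <- arrow_comp, comp_assoc, e, comp_idl.
Qed.

Lemma cobase_ext (I J X : B) (P : product I X) (Q : product J X) (u : hom I J)
    (b : fibre p Q) (G : fibre p I)
    (k k' : hom G (S I X P (reindex p (times_id P Q u) b))) :
  cobase P u b ∘ arrow k = cobase P u b ∘ arrow k' -> k = k'.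
Proof.
  unfold cobase; rewrite <- !comp_assoc; intros e.
  apply (vertical_cart_ext (a := coproduct_bc S P u b ∘ k)
           (b := coproduct_bc S P u b ∘ k')) in e.
  destruct (scoprod_bc S P u b) as (i & ei & _).
  now rewrite <- (comp_idl k), <- (comp_idl k'), <- ei, <- !comp_assoc, e.
Qed.

(** * Quantifier-free objects *)

Lemma free_reindex (I J : B) (u : hom I J) (a : fibre p J) :
  coprod_quantifier_free S a -> coprod_quantifier_free S (reindex p u a).
Proof.
  intros H A X f P b; rewrite <- reindex_comp; apply H.
Qed.

Lemma graph_eta_arrow (I X : B) (P : product I X) (b : fibre p P) (g : hom I X) :
  arrow (graph_eta S b g) = coinj b ∘ cart (graph P g) b.
Proof.
  unfold graph_eta; rewrite arrow_comp, cart_section; unfold coinj; rewrite <- !comp_assoc; f_equal.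
  apply cart_natural.
Qed.

(** Quantifier-freeness without reference to vertical arrows: the pair of a
    witness [g] and a vertical arrow into [⟨1, g⟩^* (u × 1)^* b] is the same thing
    as a single arrow into [b]. *)
Lemma free_lifts_coinj (I : B) (G : fibre p I) :
  coprod_quantifier_free S G ->
  forall (J X : B) (P : product J X) (b : fibre p P),
    lifts_uniquely (coinj b) (total G).
Proof.
  intros free J X P b h.
  destruct (over_exists h) as [u Hu].
  set (Q := I × X : product I X).
  set (s := times_id Q P u).
  set (b' := reindex p s b).
  destruct (cobase_exists Q Hu) as [h' eh].
  pose proof (free I X (idn I)) as fr; rewrite reindex_id in fr.
  destruct (fr Q b' h') as [gk [ek uk]].
  (* the arrow into [b] that corresponds to a witness and a vertical arrow *)
  set (tot := fun gk : {g : hom I X & hom G (reindex p (graph Q g) b')} =>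
    cart s b ∘ (cart (graph Q (projT1 gk)) b' ∘ arrow (projT2 gk))).
  assert (tot_over : forall gk, coinj b ∘ tot gk
    = cobase Q u b ∘ arrow (graph_eta S b' (projT1 gk) ∘ projT2 gk)).
  { intros [g k]; unfold tot; simpl projT1; simpl projT2.
    rewrite arrow_comp, graph_eta_arrow, !comp_assoc; do 2 f_equal.
    symmetry; apply cobase_coinj. }
  exists (tot gk); split.
  - now rewrite tot_over, <- ek.
  - intros k Hk.
    destruct (over_exists k) as [v Hv].
    (* the base arrow of a factorization of [h] is [⟨u, g⟩] for its witness [g] *)
    assert (ev : s ∘ graph Q (pr2 P ∘ v) = v).
    { unfold s, times_id, graph; apply product_ext; rewrite comp_assoc.
      - rewrite pr1_pairing, <- comp_assoc, pr1_pairing, comp_idr.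
        rewrite <- Hk in Hu.
        exact (over_unique Hu (lies_over_comp (coinj_over b) Hv)).
      - now rewrite pr2_pairing, pr2_pairing. }
    rewrite <- ev in Hv.
    destruct (cart_exists Hv) as (k1 & Hk1 & e1).
    destruct (vertical_cart_exists Hk1) as [k2 e2].
    set (gk' := existT (fun g => hom G (reindex p (graph Q g) b')) (pr2 P ∘ v) k2).
    assert (et : tot gk' = k) by (rewrite <- e1, <- e2; reflexivity).
    rewrite <- et; f_equal; apply uk.
    apply (cobase_ext (P := Q) (u := u) (b := b)).
    now rewrite <- tot_over, et, Hk.
Qed.

(** By [free_lifts_coinj] both [f] and [coinj b] represent, on quantifier-free
    objects, the same thing.  Every object [Z] over [I] is of the form [∐ G] with
    [G] quantifier-free, and arrows out of [∐ G] are determined by their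
    restrictions along [coinj G], so this suffices to invert the comparison
    [phi : ∐_P b -> L]. *)
Lemma coprod_iso_of_lifts (en : enough_quantifier_free S) (I X : B)
    (P : product I X) (b : fibre p P) (L : fibre p I)
    (f : hom (total b) (total L)) :
  lies_over (pr1 P) f ->
  (forall (J : B) (G : fibre p J), coprod_quantifier_free S G ->
     lifts_uniquely f (total G)) ->
  isomorphic (C := fibre p I) L (S I X P b).
Proof.
  intros Hf lifts.
  destruct (coprod_desc Hf) as [phi ephi].
  (* [phi] is monic, so that a right inverse of it is an inverse *)
  assert (phi_inj : forall (Z : fibre p I) (r r' : hom Z (S I X P b)),
    phi ∘ r = phi ∘ r' -> r = r').
  { intros Z r r' e.
    destruct (en I Z) as (A & G & free & i & j & eji & eij).
    assert (H : r ∘ j = r' ∘ j).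
    { apply coprod_ext.
      destruct (free_lifts_coinj free (arrow (r ∘ j) ∘ coinj G))
        as [k [ek _]].
      destruct (free_lifts_coinj free (arrow (r' ∘ j) ∘ coinj G))
        as [k' [ek' _]].
      rewrite <- ek, <- ek'; f_equal.
      destruct (lifts _ G free (f ∘ k')) as [k0 [_ uk0]].
      transitivity k0; [symmetry |]; apply uk0; [| reflexivity].
      rewrite <- ephi, <- !comp_assoc, ek, ek', !comp_assoc; f_equal.
      now rewrite <- !arrow_comp, !comp_assoc, e. }
    now rewrite <- (comp_idr r), <- (comp_idr r'), <- eji, !comp_assoc, H. }
  destruct (en I L) as (A & G & free & i & j & eji & eij).
  destruct (lifts _ G free (arrow j ∘ coinj G)) as [k [ek _]].
  assert (Hk : lies_over (pr1 (I × A)) (coinj b ∘ k)).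
  { apply (over_vertical_cancel (g := phi)).
    rewrite comp_assoc, ephi, ek; apply over_vertical_l, coinj_over. }
  destruct (coprod_desc Hk) as [chi echi].
  assert (e : phi ∘ (chi ∘ i) = idn L).
  { rewrite comp_assoc, <- eji; f_equal.
    apply coprod_ext.
    now rewrite arrow_comp, <- comp_assoc, echi, comp_assoc, ephi. }
  exists (chi ∘ i), phi; split; [exact e |].
  apply phi_inj; now rewrite comp_assoc, e, comp_idl, comp_idr.
Qed.

End Coproducts.

(** * Simple products *)

Section Products.
Variable S : simple_products p.

(** Instantiation of a universal quantifier, as an arrow of the total
    category. *)
Definition proj_eps (I X : B) (P : product I X) (b : fibre p P) :
    hom (total (reindex p (pr1 P) (S I X P b))) (total b) :=
  arrow (eps (radj_adjunction (S I X P)) b).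

(** Transposition along [π^* ⊣ ∏] for arrows over an arbitrary [u].  It is a
    relation so that the intermediate arrow [m], the reindexing of [h] along the
    projections, need not be named by a term depending on the proof that [h] lies
    over [u]. *)
Definition transposes (I J X : B) (P : product I X) (Q : product J X)
    (u : hom I J) (D : fibre p I) (b : fibre p Q)
    (h : hom (total D) (total (S J X Q b)))
    (k : hom (total (reindex p (pr1 P) D)) (total b)) : Prop :=
  exists m : hom (total (reindex p (pr1 P) D))
                 (total (reindex p (pr1 Q) (S J X Q b))),
    lies_over (times_id P Q u) m /\
    cart (pr1 Q) (S J X Q b) ∘ m = h ∘ cart (pr1 P) D /\
    proj_eps b ∘ m = k.

Lemma transpose_exists (I J X : B) (P : product I X) (Q : product J X)
    (u : hom I J) (D : fibre p I) (b : fibre p Q)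
    (h : hom (total D) (total (S J X Q b))) :
  lies_over u h ->
  exists k : hom (total (reindex p (pr1 P) D)) (total b), transposes u h k.
Proof.
  intros H; pose proof (lies_over_comp H (cart_over (pr1 P) D)) as H'.
  rewrite <- (times_id_square P Q u) in H'.
  destruct (cart_exists H') as (m & Hm & e).
  exists (proj_eps b ∘ m), m; auto.
Qed.

Lemma transposes_over (I J X : B) (P : product I X) (Q : product J X)
    (u : hom I J) (D : fibre p I) (b : fibre p Q)
    (h : hom (total D) (total (S J X Q b)))
    (k : hom (total (reindex p (pr1 P) D)) (total b)) :
  transposes u h k -> lies_over (times_id P Q u) k.
Proof. intros (m & Hm & _ & <-); now apply over_vertical_l. Qed.

Lemma transposes_fun (I J X : B) (P : product I X) (Q : product J X)
    (u : hom I J) (D : fibre p I) (b : fibre p Q)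
    (h : hom (total D) (total (S J X Q b)))
    (k k' : hom (total (reindex p (pr1 P) D)) (total b)) :
  transposes u h k -> transposes u h k' -> k = k'.
Proof.
  intros (m & Hm & e & <-) (m' & Hm' & e' & <-); f_equal.
  apply (cart_ext Hm Hm'); now rewrite e.
Qed.

(** Naturality of transposition in [D]. *)
Lemma transposes_comp (I0 I J X : B) (P0 : product I0 X) (P : product I X)
    (Q : product J X) (v : hom I0 I) (u : hom I J) (D0 : fibre p I0)
    (D : fibre p I) (b : fibre p Q)
    (h : hom (total D) (total (S J X Q b)))
    (k : hom (total (reindex p (pr1 P) D)) (total b))
    (h0 : hom (total D0) (total D))
    (n : hom (total (reindex p (pr1 P0) D0)) (total (reindex p (pr1 P) D))) :
  transposes u h k -> lies_over (times_id P0 P v) n ->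
  cart (pr1 P) D ∘ n = h0 ∘ cart (pr1 P0) D0 ->
  transposes (u ∘ v) (h ∘ h0) (k ∘ n).
Proof.
  intros (m & Hm & e & <-) Hn en; exists (m ∘ n); repeat split.
  - rewrite <- (times_id_comp P0 P Q); exact (lies_over_comp Hm Hn).
  - now rewrite comp_assoc, e, <- !comp_assoc, en.
  - apply comp_assoc.
Qed.

(** Transposition within a single fibre. *)
Definition prod_desc (I X : B) (P : product I X) (D : fibre p I) (b : fibre p P)
    (h : hom D (S I X P b)) : hom (reindex p (pr1 P) D) b :=
  eps (radj_adjunction (S I X P)) b ∘ fmap (reindex p (pr1 P)) h.

Lemma prod_desc_transpose (I X : B) (P : product I X) (D : fibre p I)
    (b : fibre p P) (k : hom (reindex p (pr1 P) D) b) :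
  prod_desc (fmap (S I X P) k ∘ eta (radj_adjunction (S I X P)) D) = k.
Proof.
  set (ad := radj_adjunction (S I X P)); unfold prod_desc; fold ad.
  now rewrite fmap_comp, comp_assoc, (eps_natural ad), <- comp_assoc,
    (triangle_left ad), comp_idr.
Qed.

Lemma prod_desc_inj (I X : B) (P : product I X) (D : fibre p I) (b : fibre p P)
    (h h' : hom D (S I X P b)) : prod_desc h = prod_desc h' -> h = h'.
Proof.
  set (ad := radj_adjunction (S I X P)).
  assert (H : forall h : hom D (S I X P b),
    h = fmap (S I X P) (prod_desc h) ∘ eta ad D).
  { intros g; unfold prod_desc; fold ad.
    now rewrite fmap_comp, <- comp_assoc, <- (eta_natural ad), comp_assoc,
      (triangle_right ad), comp_idl. }
  intros e; now rewrite (H h), (H h'), e.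
Qed.

(** Transposition over [u] is the vertical transposition over [I] preceded by the
    Beck-Chevalley arrow; hence it is bijective because the latter is
    invertible. *)
Lemma transposes_bc (I J X : B) (P : product I X) (Q : product J X)
    (u : hom I J) (D : fibre p I) (b : fibre p Q)
    (h : hom D (reindex p u (S J X Q b))) :
  transposes u (cart u _ ∘ arrow h)
    (cart (times_id P Q u) b ∘ arrow (prod_desc (product_bc S P u b ∘ h))).
Proof.
  set (s := times_id P Q u).
  set (L := S J X Q b).
  set (ad := radj_adjunction (S I X P)).
  set (ad' := radj_adjunction (S J X Q)).
  set (sq := eq_hom (eq_sym (reindex_square (times_id_square P Q u) L))).
  exists (cart s (reindex p (pr1 Q) L)
            ∘ arrow (sq ∘ fmap (reindex p (pr1 P)) h)).
  assert (H : prod_desc (product_bc S P u b ∘ h)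
    = fmap (reindex p s) (eps ad' b) ∘ (sq ∘ fmap (reindex p (pr1 P)) h)).
  { rewrite comp_assoc; unfold prod_desc at 1; rewrite fmap_comp, comp_assoc.
    f_equal; apply (prod_desc_transpose (D := reindex p u L)). }
  repeat split.
  - apply over_vertical_r, cart_over.
  - rewrite arrow_comp, !comp_assoc; unfold sq; rewrite cart_square_sym.
    rewrite <- !comp_assoc; f_equal; apply cart_natural.
  - fold s L in H; rewrite H, !arrow_comp, !comp_assoc; do 2 f_equal; symmetry; apply cart_natural.
Qed.

Lemma transposes_surj (I J X : B) (P : product I X) (Q : product J X)
    (u : hom I J) (D : fibre p I) (b : fibre p Q)
    (k : hom (total (reindex p (pr1 P) D)) (total b)) :
  lies_over (times_id P Q u) k ->
  exists h : hom (total D) (total (S J X Q b)), lies_over u h /\ transposes u h k.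
Proof.
  intros H; destruct (vertical_cart_exists H) as [k1 <-].
  rewrite <- (prod_desc_transpose k1); set (h1 := fmap _ k1 ∘ _).
  destruct (sprod_bc S P u b) as (i & _ & e).
  rewrite <- (comp_idl h1), <- e, <- comp_assoc.
  exists (cart u (S J X Q b) ∘ arrow (i ∘ h1)); split.
  - apply over_vertical_r, cart_over.
  - apply transposes_bc.
Qed.

Lemma transposes_inj (I J X : B) (P : product I X) (Q : product J X)
    (u : hom I J) (D : fibre p I) (b : fibre p Q)
    (h h' : hom (total D) (total (S J X Q b)))
    (k : hom (total (reindex p (pr1 P) D)) (total b)) :
  lies_over u h -> lies_over u h' ->
  transposes u h k -> transposes u h' k -> h = h'.
Proof.
  intros H H' t t'.
  destruct (vertical_cart_exists H) as [h1 <-].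
  destruct (vertical_cart_exists H') as [h1' <-].
  do 2 f_equal.
  destruct (sprod_bc S P u b) as (i & e & _).
  rewrite <- (comp_idl h1), <- (comp_idl h1'), <- e, <- !comp_assoc; f_equal.
  apply prod_desc_inj.
  apply (vertical_cart_ext (u := times_id P Q u)).
  rewrite <- (transposes_fun t (transposes_bc P h1)).
  apply (transposes_fun t'), transposes_bc.
Qed.

End Products.

(** * Skolemization *)

Section Skolem.
Variables (A1 A2 Y : B) (ex : exponential A2 Y).
Local Notation W := (exp_ob ex).

Definition apply_graph : hom (A1 × A2 × W) (A1 × A2 × Y) :=
  ⟨⟨tpr1 A1 A2 W, tpr2 A1 A2 W⟩, ev ex ∘ ⟨tpr2 A1 A2 W, tpr3 A1 A2 W⟩⟩.

Lemma apply_graph_over :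
  pr1 (proj12 A1 A2 Y) ∘ apply_graph
  = times_id (proj13 A1 A2 W) (A1 × A2) (pr1 (A1 × W)).
Proof.
  unfold times_id, apply_graph; simpl.
  rewrite pairing_comp, tpr1_pairing, tpr2_pairing, pr1_pairing; reflexivity.
Qed.

Lemma apply_graph_times (C : B) (v : hom C (A1 × W)) :
  apply_graph ∘ times_id (C × A2) (proj13 A1 A2 W) v
  = ⟨⟨pr1 _ ∘ v ∘ pr1 (C × A2), pr2 (C × A2)⟩,
     ev ex ∘ ⟨pr2 (C × A2), pr2 _ ∘ v ∘ pr1 (C × A2)⟩⟩.
Proof.
  unfold apply_graph, times_id; simpl.
  rewrite !pairing_comp, <- (comp_assoc (ev ex)), pairing_comp.
  now rewrite tpr1_pairing, tpr2_pairing, tpr3_pairing, !comp_assoc.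
Qed.

(** The exponential has its argument as first factor, whereas the projections
    to be handled have base [C] as first factor; hence the swap. *)
Lemma ev_pairing (C : B) (w : hom C W) (f : hom (A2 × C) Y) :
  ev ex ∘ ⟨pr2 (C × A2), w ∘ pr1 (C × A2)⟩ = f ∘ ⟨pr2 (C × A2), pr1 (C × A2)⟩ <->
  w = curry ex f.
Proof.
  split.
  - intros e; apply curry_unique.
    apply (f_equal (fun k => k ∘ ⟨pr2 (A2 × C), pr1 (A2 × C)⟩)) in e.
    rewrite <- !comp_assoc, !pairing_comp, <- comp_assoc, pr1_pairing,
      pr2_pairing in e.
    rewrite e.
    rewrite <- (pairing_unique (p := A2 × C) (h := idn _));
      [apply comp_idr | apply comp_idr | apply comp_idr].
  - intros ->.
    pose proof (f_equal (fun k => k ∘ ⟨pr2 (C × A2), pr1 (C × A2)⟩)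
      (ev_curry ex f)) as e; cbv beta in e; rewrite <- e.
    now rewrite <- !comp_assoc, !pairing_comp, <- comp_assoc, pr1_pairing,
      pr2_pairing.
Qed.

(** The third component of [g], as a function of its second argument, is the
    Skolem function. *)
Lemma skolem_function_exists (C : B) (u : hom C A1) (g : hom (C × A2) (A1 × A2 × Y)) :
  pr1 (proj12 A1 A2 Y) ∘ g = times_id (C × A2) (A1 × A2) u ->
  exists v : hom C (A1 × W), pr1 (A1 × W) ∘ v = u /\
    apply_graph ∘ times_id (C × A2) (proj13 A1 A2 W) v = g.
Proof.
  intros Hg.
  set (f := tpr3 A1 A2 Y ∘ g ∘ ⟨pr2 (A2 × C), pr1 (A2 × C)⟩).
  exists ⟨u, curry ex f⟩; split; [apply pr1_pairing |].
  rewrite apply_graph_times, pr1_pairing, pr2_pairing.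
  rewrite (proj2 (ev_pairing (curry ex f) f) eq_refl).
  simpl in Hg; rewrite pairing_comp in Hg.
  pose proof (f_equal (fun k => pr1 (A1 × A2) ∘ k) Hg) as e1.
  pose proof (f_equal (fun k => pr2 (A1 × A2) ∘ k) Hg) as e2.
  unfold times_id in e1, e2; simpl in e1, e2.
  rewrite !pr1_pairing in e1; rewrite !pr2_pairing in e2.
  apply triple_ext;
    rewrite ?tpr1_pairing, ?tpr2_pairing, ?tpr3_pairing; trivial.
  - now symmetry.
  - now symmetry.
  - unfold f; rewrite <- !comp_assoc, pairing_comp, pr1_pairing, pr2_pairing.
    rewrite <- (pairing_unique (p := C × A2) (h := idn _));
      [now rewrite comp_idr | apply comp_idr | apply comp_idr].
Qed.

Lemma skolem_function_unique (C : B) (v v' : hom C (A1 × W)) :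
  pr1 (A1 × W) ∘ v = pr1 (A1 × W) ∘ v' ->
  apply_graph ∘ times_id (C × A2) (proj13 A1 A2 W) v
  = apply_graph ∘ times_id (C × A2) (proj13 A1 A2 W) v' ->
  v = v'.
Proof.
  intros e1 e2; apply product_ext; [exact e1 |].
  rewrite !apply_graph_times in e2.
  apply (f_equal (fun k => tpr3 A1 A2 Y ∘ k)) in e2; rewrite !tpr3_pairing in e2.
  set (f := ev ex ∘ ⟨pr1 (A2 × C), (pr2 (A1 × W) ∘ v') ∘ pr2 (A2 × C)⟩).
  transitivity (curry ex f); [| symmetry]; apply ev_pairing.
  1: rewrite e2.
  all: unfold f; now rewrite <- (comp_assoc (ev ex)), pairing_comp,
    <- (comp_assoc (_ ∘ v')), pr1_pairing, pr2_pairing.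
Qed.

Variables (Sp : simple_products p) (Sc : simple_coproducts p).
Variable alpha : fibre p (A1 × A2 × Y).

Local Notation chosen := (Sp _ _ (proj13 A1 A2 W) (reindex p apply_graph alpha)).
Local Notation every := (Sp _ _ (A1 × A2) (Sc _ _ (proj12 A1 A2 Y) alpha)).

(** Both directions compare arrows [G -> chosen] and [G -> every] through their
    transposes: the transpose of [f ∘ k] is the transpose of [k] followed by the
    cartesian arrow into [alpha] and by [coinj alpha]. *)
Lemma choice_lifts (f : hom (total chosen) (total every)) :
  lies_over (pr1 (A1 × W)) f ->
  transposes (P := proj13 A1 A2 W) (Q := A1 × A2) (pr1 (A1 × W)) f
    (coinj Sc (P := proj12 A1 A2 Y) alpha
       ∘ cart apply_graph alpha ∘ proj_eps Sp (P := proj13 A1 A2 W) _) ->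
  forall (C : B) (G : fibre p C), coprod_quantifier_free Sc G ->
    lifts_uniquely f (total G).
Proof.
  intros Hf tf C G free h.
  set (Q := C × A2).
  assert (comp_tr : forall v (k : hom (total G) (total chosen)) k',
    transposes (P := Q) (Q := proj13 A1 A2 W) v k k' ->
    transposes (P := Q) (Q := A1 × A2) (pr1 (A1 × W) ∘ v) (f ∘ k)
      (coinj Sc (P := proj12 A1 A2 Y) alpha ∘ (cart apply_graph alpha ∘ k'))).
  { intros v k k' (m & Hm & em & <-).
    rewrite !comp_assoc.
    exact (transposes_comp tf Hm em). }
  destruct (over_exists h) as [u Hu].
  destruct (transpose_exists Q (Q := A1 × A2) Hu) as [h' th].
  (* [q] contains the witness of the existential quantifier; its base arrow [g]
     yields the Skolem function *)
  destruct (free_lifts_coinj (free_reindex (u := pr1 Q) free)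
    (P := proj12 A1 A2 Y) (b := alpha) h') as [q [eq uq]].
  destruct (over_exists q) as [g Hg].
  assert (eg : pr1 (proj12 A1 A2 Y) ∘ g = times_id Q (A1 × A2) u).
  { apply (over_unique (f := h')); [| exact (transposes_over th)].
    rewrite <- eq; exact (lies_over_comp (coinj_over Sc (P := proj12 A1 A2 Y) alpha) Hg). }
  destruct (skolem_function_exists eg) as (v & ev1 & ev2).
  rewrite <- ev2 in Hg; destruct (cart_exists Hg) as (k' & Hk' & ek').
  destruct (transposes_surj Sp (P := Q) (Q := proj13 A1 A2 W) (D := G) Hk') as (k & Hk & tk).
  assert (fk : f ∘ k = h).
  { subst u; apply (transposes_inj (P := Q) (k := h') (lies_over_comp Hf Hk) Hu);
      [| exact th].
    rewrite <- eq, <- ek'; now apply comp_tr. }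
  exists k; split; [exact fk |].
  intros l el.
  destruct (over_exists l) as [w Hw].
  destruct (transpose_exists Q (Q := proj13 A1 A2 W) Hw) as [l' tl].
  assert (ew : pr1 (A1 × W) ∘ w = u).
  { rewrite <- el in Hu; exact (over_unique (lies_over_comp Hf Hw) Hu). }
  assert (el' : q = cart apply_graph alpha ∘ l').
  { apply uq, (transposes_fun (h := h)(u := u)); [| exact th].
    rewrite <- el, <- ew; now apply comp_tr. }
  assert (evw : v = w).
  { apply skolem_function_unique; [congruence |].
    apply (over_unique Hg); rewrite el'.
    exact (lies_over_comp (cart_over _ _) (transposes_over tl)). }
  subst w.
  (* [k] and [l] lie over the same arrow, so their transposes determine them *)
  apply (transposes_inj Hk Hw tk).
  replace k' with l'; [exact tl |].
  exact (cart_ext (transposes_over tl) Hk' (eq_trans (eq_sym el') (eq_sym ek'))).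
Qed.

Lemma skolem_iso (en : enough_quantifier_free Sc) :
  isomorphic (C := fibre p A1) every (Sc _ _ (A1 × W) chosen).
Proof.
  assert (H : lies_over (times_id (proj13 A1 A2 W) (A1 × A2) (pr1 (A1 × W)))
    (coinj Sc (P := proj12 A1 A2 Y) alpha
       ∘ cart apply_graph alpha ∘ proj_eps Sp (P := proj13 A1 A2 W) _)).
  { rewrite <- apply_graph_over; apply over_vertical_r.
    exact (lies_over_comp (coinj_over Sc (P := proj12 A1 A2 Y) alpha)
             (cart_over apply_graph alpha)). }
  destruct (transposes_surj Sp (P := proj13 A1 A2 W) (Q := A1 × A2) H) as (f & Hf & tf).
  exact (coprod_iso_of_lifts en Hf (choice_lifts Hf tf)).
Qed.

End Skolem.
End Quantifiers.

Theorem proposition3p7 (E : category) (B : fp_category) (p : split_fibration E B)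
    (S : skolem_fibration p) (A1 A2 Y : B) (alpha : fibre p (A1 × A2 × Y)) :
  isomorphic (C := fibre p A1)
    (Forall S (A1 × A2) (Exists S (proj12 A1 A2 Y) alpha))
    (Exists S (A1 × power S Y A2)
       (Forall S (proj13 A1 A2 (power S Y A2))
          (reindex p
             ⟨⟨tpr1 A1 A2 (power S Y A2), tpr2 A1 A2 (power S Y A2)⟩,
              evaluation S Y A2
                ∘ ⟨tpr2 A1 A2 (power S Y A2), tpr3 A1 A2 (power S Y A2)⟩⟩
             alpha))).
Proof. exact (skolem_iso (sk_closed S A2 Y) (sk_prod S) alpha (sk_enough S)). Qed.
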